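(* Assume that $\mathbf{E}_{\mathrm{im}}=\mathbf{E}_{\mathrm{im}}(\mu)$ is non-singular for all $\mu\in\mathcal{P}$. Let $\mathbf{y}^k=\mathbf{C}\mathbf{x}^k$ be the output of the full-order model at time $t^k$, and let $$\overline{\mathbf{y}}^k_{\mathrm{im,c}}:=\widehat{\mathbf{y}}^k_{\mathrm{im,c}}-\widetilde{\mathbf{x}}_{\mathrm{du}}^{\mathsf T}\,\mathbf{r}^k_{\mathrm{im,c}}$$ be the modified output of the corrected reduced-order model. Then, for every $\mu\in\mathcal{P}$ and every time step $k\in\{1,\dots,K\}$, $$\|\mathbf{y}^k-\overline{\mathbf{y}}^k_{\mathrm{im,c}}\|\le\|\mathbf{E}_{\mathrm{im}}^{-1}\|\,\|\mathbf{r}_{\mathrm{du}}\|\,\|\breve{\mathbf{r}}^k_{\mathrm{im,c}}\|+\|\widetilde{\mathbf{x}}_{\mathrm{du}}\|\,\|\mathbf{r}^k_{\mathrm{im,c}}-\breve{\mathbf{r}}^k_{\mathrm{im,c}}\|.$$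
   Context: All quantities depend on a parameter $\mu\in\mathcal{P}\subset\mathbb{R}^p$; this dependence is suppressed. $\|\cdot\|$ is the Euclidean norm for vectors and the induced spectral norm for matrices. Full-order model (FOM): $\frac{d}{dt}\mathbf{x}=\mathbf{A}\mathbf{x}+\mathbf{f}(\mathbf{x})+\mathbf{B}\mathbf{u}(t)$, $\mathbf{x}(0)=\mathbf{x}_0$, $\mathbf{y}=\mathbf{C}\mathbf{x}$, with $\mathbf{A}\in\mathbb{R}^{N\times N}$, $\mathbf{f}:\mathbb{R}^N\to\mathbb{R}^N$, $\mathbf{B}\in\mathbb{R}^{N\times N_I}$, $\mathbf{C}\in\mathbb{R}^{N_O\times N}$. Let $\mathbf{x}^0,\mathbf{x}^1,\dots,\mathbf{x}^K\in\mathbb{R}^N$ be the solution snapshots of the FOM at times $t^0,\dots,t^K$ (with step $\delta t>0$) delivered by an arbitrary ODE solver, with $\mathbf{x}^0=\mathbf{x}_0$, and $\mathbf{y}^k:=\mathbf{C}\mathbf{x}^k$. Put $\mathbf{u}^k:=\mathbf{u}(t^k)$, $\mathbf{E}_{\mathrm{im}}:=\mathbf{I}_N-\delta t\,\mathbf{A}$, $\mathbf{A}_{\mathrm{im}}:=\mathbf{I}_N$ (first-order implicit-explicit scheme). Defect vector: $\mathbf{d}^k:=\mathbf{E}_{\mathrm{im}}\mathbf{x}^k-\big(\mathbf{A}_{\mathrm{im}}\mathbf{x}^{k-1}+\delta t(\mathbf{f}(\mathbf{x}^{k-1})+\mathbf{B}\mathbf{u}^k)\big)$, $k=1,\dots,K$.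 Corrected FOM (C-FOM): $\mathbf{E}_{\mathrm{im}}\mathbf{x}^k_{\mathrm{im,c}}=\mathbf{A}_{\mathrm{im}}\mathbf{x}^{k-1}_{\mathrm{im,c}}+\delta t(\mathbf{f}(\mathbf{x}^{k-1}_{\mathrm{im,c}})+\mathbf{B}\mathbf{u}^k)+\mathbf{d}^k$, with $\mathbf{x}^0_{\mathrm{im,c}}=\mathbf{x}^0$, and output $\mathbf{y}^k_{\mathrm{im,c}}=\mathbf{C}\mathbf{x}^k_{\mathrm{im,c}}$. Corrected reduced-order model (C-ROM): for $\mathbf{V}\in\mathbb{R}^{N\times n}$ with orthonormal columns, let $\widehat{\mathbf{E}}_{\mathrm{im}}:=\mathbf{I}_n-\delta t\,\mathbf{V}^{\mathsf T}\mathbf{A}\mathbf{V}$, $\widehat{\mathbf{A}}_{\mathrm{im}}:=\mathbf{I}_n$, $\widehat{\mathbf{f}}:=\mathbf{V}^{\mathsf T}\mathbf{f}$, $\widehat{\mathbf{B}}:=\mathbf{V}^{\mathsf T}\mathbf{B}$, $\widehat{\mathbf{C}}:=\mathbf{C}\mathbf{V}$, $\widehat{\mathbf{d}}^k:=\mathbf{V}^{\mathsf T}\mathbf{d}^k$. The C-ROM is $$\widehat{\mathbf{E}}_{\mathrm{im}}\widehat{\mathbf{x}}^k_{\mathrm{im,c}}=\widehat{\mathbf{A}}_{\mathrm{im}}\widehat{\mathbf{x}}^{k-1}_{\mathrm{im,c}}+\delta t\big(\widehat{\mathbf{f}}(\widetilde{\mathbf{x}}^{k-1}_{\mathrm{im,c}})+\widehat{\mathbf{B}}\mathbf{u}^k\big)+\widehat{\mathbf{d}}^k,\qquad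 \widehat{\mathbf{y}}^k_{\mathrm{im,c}}=\widehat{\mathbf{C}}\widehat{\mathbf{x}}^k_{\mathrm{im,c}},$$ with $\widehat{\mathbf{x}}^0_{\mathrm{im,c}}=\mathbf{V}^{\mathsf T}\mathbf{x}_0$ and $\widetilde{\mathbf{x}}^k_{\mathrm{im,c}}:=\mathbf{V}\widehat{\mathbf{x}}^k_{\mathrm{im,c}}$. Dual system: $\mathbf{E}_{\mathrm{du}}\mathbf{x}_{\mathrm{du}}=\mathbf{C}_{\mathrm{du}}$ with $\mathbf{E}_{\mathrm{du}}:=\mathbf{E}_{\mathrm{im}}^{\mathsf T}$, $\mathbf{C}_{\mathrm{du}}:=-\mathbf{C}^{\mathsf T}$, so $\mathbf{x}_{\mathrm{du}}\in\mathbb{R}^{N\times N_O}$ (a vector in $\mathbb{R}^N$ for a single output). Dual reduced system: for a projection matrix $\mathbf{V}_{\mathrm{du}}$ with $N$ rows, $\widehat{\mathbf{E}}_{\mathrm{du}}\widehat{\mathbf{x}}_{\mathrm{du}}=\widehat{\mathbf{C}}_{\mathrm{du}}$ with $\widehat{\mathbf{E}}_{\mathrm{du}}:=\mathbf{V}_{\mathrm{du}}^{\mathsf T}\mathbf{E}_{\mathrm{du}}\mathbf{V}_{\mathrm{du}}$, $\widehat{\mathbf{C}}_{\mathrm{du}}:=\mathbf{V}_{\mathrm{du}}^{\mathsf T}\mathbf{C}_{\mathrm{du}}$, and $\widetilde{\mathbf{x}}_{\mathrm{du}}:=\mathbf{V}_{\mathrm{du}}\widehat{\mathbf{x}}_{\mathrm{du}}$.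 The C-ROM and the dual reduced system are assumed to have the solutions named here. Residuals: $$\mathbf{r}^k_{\mathrm{im,c}}:=\mathbf{A}_{\mathrm{im}}\widetilde{\mathbf{x}}^{k-1}_{\mathrm{im,c}}+\delta t\big(\mathbf{f}(\widetilde{\mathbf{x}}^{k-1}_{\mathrm{im,c}})+\mathbf{B}\mathbf{u}^k\big)+\mathbf{d}^k-\mathbf{E}_{\mathrm{im}}\widetilde{\mathbf{x}}^k_{\mathrm{im,c}},$$ $$\mathbf{r}_{\mathrm{du}}:=\mathbf{C}_{\mathrm{du}}-\mathbf{E}_{\mathrm{du}}\widetilde{\mathbf{x}}_{\mathrm{du}},$$ and the auxiliary residual $$\breve{\mathbf{r}}^k_{\mathrm{im,c}}:=\mathbf{A}_{\mathrm{im}}\mathbf{x}^{k-1}_{\mathrm{im,c}}+\delta t\big(\mathbf{f}(\mathbf{x}^{k-1}_{\mathrm{im,c}})+\mathbf{B}\mathbf{u}^k\big)+\mathbf{d}^k-\mathbf{E}_{\mathrm{im}}\widetilde{\mathbf{x}}^k_{\mathrm{im,c}}.$$ *)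

(* Defs.v *)
From HB Require Import structures.
From mathcomp Require Import all_boot all_order all_algebra.
From mathcomp Require Import classical_sets reals.

Set Implicit Arguments.
Unset Strict Implicit.
Unset Printing Implicit Defensive.

Import Order.TTheory GRing.Theory Num.Theory.

Local Open Scope classical_set_scope.
Local Open Scope ring_scope.

(* MathComp-Analysis equips matrices with the max norm `|A|, so the Euclidean
   norm and the spectral norm it induces are defined here. *)
Definition enorm (R : realType) (m : nat) (v : 'cV[R]_m) : R :=
  Num.sqrt (\sum_i v i 0 ^+ 2).

(* The supremum is over the closed unit ball rather than the unit sphere, so
   that the set is nonempty also for n = 0. *)
Definition specnorm (R : realType) (m n : nat) (M : 'M[R]_(m, n)) : R :=
  sup [set enorm (M *m v) | v in [set v : 'cV[R]_n | enorm v <= 1]].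

(* dx/dt = A x + f(x) + B u(t),  x(0) = x0,  y = C x, for one parameter value. *)
Record fom (R : realType) (N NI NO : nat) := Fom {
  fomA : 'M[R]_N;
  fomf : 'cV[R]_N -> 'cV[R]_N;
  fomB : 'M[R]_(N, NI);
  fomC : 'M[R]_(NO, N);
  fomu : R -> 'cV[R]_NI;
  fomx0 : 'cV[R]_N
}.

Definition uniform_grid (R : realType) (K : nat) (dt : R) (t : nat -> R) :=
  0 < dt /\ forall k, (1 <= k <= K)%N -> t k = t k.-1 + dt.

(* In all definitions below that mention k.-1, the time index k is at least 1
   wherever they are used. *)

Definition Eim (R : realType) (N NI NO : nat) (S : fom R N NI NO) (dt : R) :
  'M[R]_N := 1%:M - dt *: fomA S.

Definition Aim (R : realType) (N : nat) : 'M[R]_N := 1%:M.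

(* A_im w + dt (f(w) + B u^k) *)
Definition imex_rhs (R : realType) (N NI NO : nat) (S : fom R N NI NO)
    (dt : R) (t : nat -> R) (k : nat) (w : 'cV[R]_N) : 'cV[R]_N :=
  Aim R N *m w + dt *: (fomf S w + fomB S *m fomu S (t k)).

(* d^k, for the snapshots x *)
Definition defect (R : realType) (N NI NO : nat) (S : fom R N NI NO)
    (dt : R) (t : nat -> R) (x : nat -> 'cV[R]_N) (k : nat) : 'cV[R]_N :=
  Eim S dt *m x k - imex_rhs S dt t k (x k.-1).

Definition cfom_solution (R : realType) (N NI NO : nat) (S : fom R N NI NO)
    (K : nat) (dt : R) (t : nat -> R) (x xc : nat -> 'cV[R]_N) : Prop :=
  xc 0%N = x 0%N /\
  forall k, (1 <= k <= K)%N ->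
    Eim S dt *m xc k = imex_rhs S dt t k (xc k.-1) + defect S dt t x k.

Definition orthonormal_columns (R : realType) (N n : nat) (V : 'M[R]_(N, n)) :=
  V^T *m V = 1%:M.

Definition Eim_hat (R : realType) (N NI NO n : nat) (S : fom R N NI NO)
    (dt : R) (V : 'M[R]_(N, n)) : 'M[R]_n :=
  1%:M - dt *: (V^T *m fomA S *m V).

Definition f_hat (R : realType) (N NI NO n : nat) (S : fom R N NI NO)
    (V : 'M[R]_(N, n)) (w : 'cV[R]_N) : 'cV[R]_n := V^T *m fomf S w.

Definition B_hat (R : realType) (N NI NO n : nat) (S : fom R N NI NO)
    (V : 'M[R]_(N, n)) : 'M[R]_(n, NI) := V^T *m fomB S.

Definition C_hat (R : realType) (N NI NO n : nat) (S : fom R N NI NO)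
    (V : 'M[R]_(N, n)) : 'M[R]_(NO, n) := fomC S *m V.

(* z is the reduced trajectory; its lift to R^N is V *m z k. *)
Definition crom_solution (R : realType) (N NI NO n : nat) (S : fom R N NI NO)
    (K : nat) (dt : R) (t : nat -> R) (x : nat -> 'cV[R]_N)
    (V : 'M[R]_(N, n)) (z : nat -> 'cV[R]_n) : Prop :=
  z 0%N = V^T *m fomx0 S /\
  forall k, (1 <= k <= K)%N ->
    Eim_hat S dt V *m z k =
      Aim R n *m z k.-1
      + dt *: (f_hat S V (V *m z k.-1) + B_hat S V *m fomu S (t k))
      + V^T *m defect S dt t x k.

Definition Edu (R : realType) (N NI NO : nat) (S : fom R N NI NO) (dt : R) :
  'M[R]_N := (Eim S dt)^T.

Definition Cdu (R : realType) (N NI NO : nat) (S : fom R N NI NO) :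
  'M[R]_(N, NO) := - (fomC S)^T.

Definition dual_rom_solution (R : realType) (N NI NO q : nat)
    (S : fom R N NI NO) (dt : R) (Vdu : 'M[R]_(N, q)) (zdu : 'M[R]_(q, NO)) :
    Prop :=
  (Vdu^T *m Edu S dt *m Vdu) *m zdu = Vdu^T *m Cdu S.

(* xt is the lifted C-ROM trajectory in the residuals below. *)
Definition res (R : realType) (N NI NO : nat) (S : fom R N NI NO)
    (dt : R) (t : nat -> R) (x xt : nat -> 'cV[R]_N) (k : nat) : 'cV[R]_N :=
  imex_rhs S dt t k (xt k.-1) + defect S dt t x k - Eim S dt *m xt k.

Definition aux_res (R : realType) (N NI NO : nat) (S : fom R N NI NO)
    (dt : R) (t : nat -> R) (x xc xt : nat -> 'cV[R]_N) (k : nat) :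
    'cV[R]_N :=
  imex_rhs S dt t k (xc k.-1) + defect S dt t x k - Eim S dt *m xt k.

Definition res_du (R : realType) (N NI NO : nat) (S : fom R N NI NO)
    (dt : R) (xtdu : 'M[R]_(N, NO)) : 'M[R]_(N, NO) :=
  Cdu S - Edu S dt *m xtdu.

Definition modified_output (R : realType) (N NI NO n : nat)
    (S : fom R N NI NO) (dt : R) (t : nat -> R) (x : nat -> 'cV[R]_N)
    (V : 'M[R]_(N, n)) (z : nat -> 'cV[R]_n) (xtdu : 'M[R]_(N, NO))
    (k : nat) : 'cV[R]_NO :=
  C_hat S V *m z k - xtdu^T *m res S dt t x (fun j => V *m z j) k.

(* Main.v *)
(* As E_im is invertible, the corrected model reproduces the snapshots, so
   E_im (x^k - V z^k) is the auxiliary residual.  Substituting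
   C = - r_du^T - xt_du^T E_im in the output error gives
     y^k - ybar^k = - r_du^T E_im^-1 rbreve^k + xt_du^T (r^k - rbreve^k),
   and the bound follows from the triangle inequality, since a matrix and its
   transpose satisfy the same operator-norm estimate. *)
Require Import Defs.
From HB Require Import structures.
From mathcomp Require Import all_boot all_order all_algebra.
From mathcomp Require Import classical_sets reals.
From mathcomp Require Import lra.

Set Implicit Arguments.
Unset Strict Implicit.
Unset Printing Implicit Defensive.

Import Order.TTheory GRing.Theory Num.Theory.

Local Open Scope classical_set_scope.
Local Open Scope ring_scope.

Definition dotv (R : realType) (m : nat) (u v : 'cV[R]_m) : R :=
  \sum_i u i 0 * v i 0.

Lemma dotvC (R : realType) (m : nat) (u v : 'cV[R]_m) : dotv u v = dotv v u.
Proof. by apply: eq_bigr => i _; rewrite mulrC. Qed.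

Lemma dotvDl (R : realType) (m : nat) (u v w : 'cV[R]_m) :
  dotv (u + v) w = dotv u w + dotv v w.
Proof. by rewrite -big_split; apply: eq_bigr => i _; rewrite mxE mulrDl. Qed.

Lemma dotvZl (R : realType) (m : nat) (a : R) (u w : 'cV[R]_m) :
  dotv (a *: u) w = a * dotv u w.
Proof. by rewrite mulr_sumr; apply: eq_bigr => i _; rewrite mxE mulrA. Qed.

Lemma dotv_mx (R : realType) (m : nat) (u v : 'cV[R]_m) :
  (u^T *m v) 0 0 = dotv u v.
Proof. by rewrite mxE; apply: eq_bigr => i _; rewrite mxE. Qed.

Lemma dotv_trmx (R : realType) (m n : nat) (M : 'M[R]_(m, n))
    (v : 'cV[R]_m) (w : 'cV[R]_n) :
  dotv (M^T *m v) w = dotv v (M *m w).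
Proof. by rewrite -!dotv_mx trmx_mul trmxK mulmxA. Qed.

Lemma dotv_ge0 (R : realType) (m : nat) (v : 'cV[R]_m) : 0 <= dotv v v.
Proof. by apply: sumr_ge0 => i _; rewrite -expr2 sqr_ge0. Qed.

Lemma enorm_ge0 (R : realType) (m : nat) (v : 'cV[R]_m) : 0 <= enorm v.
Proof. exact: sqrtr_ge0. Qed.

Lemma sqr_enorm (R : realType) (m : nat) (v : 'cV[R]_m) :
  enorm v ^+ 2 = dotv v v.
Proof.
rewrite sqr_sqrtr; last by apply: sumr_ge0 => i _; exact: sqr_ge0.
by apply: eq_bigr => i _; rewrite expr2.
Qed.

Lemma enorm0 (R : realType) (m : nat) : enorm (0 : 'cV[R]_m) = 0.
Proof. by rewrite /enorm big1 ?sqrtr0 // => i _; rewrite mxE expr0n. Qed.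

Lemma enorm_eq0 (R : realType) (m : nat) (v : 'cV[R]_m) :
  enorm v = 0 -> v = 0.
Proof.
move=> v0; have /eqP: dotv v v = 0 by rewrite -sqr_enorm v0 expr0n.
rewrite psumr_eq0; last by move=> i _; rewrite -expr2 sqr_ge0.
move=> /allP v0i; apply/colP => i; rewrite mxE; apply/eqP.
by have := v0i i (mem_index_enum _); rewrite /= mulf_eq0 orbb.
Qed.

Lemma enormZ (R : realType) (m : nat) (a : R) (v : 'cV[R]_m) :
  enorm (a *: v) = `|a| * enorm v.
Proof.
apply/eqP; rewrite -(eqrXn2 (n := 2)) ?mulr_ge0 ?enorm_ge0 //.
by rewrite exprMn real_normK ?num_real // !sqr_enorm dotvZl dotvC dotvZl mulrA.
Qed.

Lemma enormN (R : realType) (m : nat) (v : 'cV[R]_m) : enorm (- v) = enorm v.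
Proof. by rewrite -scaleN1r enormZ normrN1 mul1r. Qed.

(** Cauchy-Schwarz. For nonzero vectors, expanding the nonnegative square of
    [enorm v *: u - enorm u *: v] gives twice [enorm u * enorm v] times the gap between the two
    sides, and this positive factor cancels. *)
Lemma dotv_le_enorm (R : realType) (m : nat) (u v : 'cV[R]_m) :
  dotv u v <= enorm u * enorm v.
Proof.
have [u0|u0] := eqVneq (enorm u) 0.
  by rewrite u0 mul0r (enorm_eq0 u0) -(scale0r (0 : 'cV_m)) dotvZl mul0r.
have [v0|v0] := eqVneq (enorm v) 0.
  by rewrite v0 mulr0 (enorm_eq0 v0) dotvC -(scale0r (0 : 'cV_m)) dotvZl mul0r.
have uv_gt0 : 0 < enorm u * enorm v.
  by rewrite mulr_gt0 // lt0r ?u0 ?v0 enorm_ge0.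
have := dotv_ge0 (enorm v *: u + (- enorm u) *: v).
rewrite dotvDl !dotvZl ![dotv _ (_ + _)]dotvC !dotvDl !dotvZl (dotvC v u).
rewrite -!sqr_enorm => h; rewrite -(ler_pM2l uv_gt0); nra.
Qed.

Lemma sqr_dotv_le (R : realType) (m : nat) (u v : 'cV[R]_m) :
  dotv u v ^+ 2 <= dotv u u * dotv v v.
Proof.
have h1 := dotv_le_enorm u v.
have h2 : - dotv u v <= enorm u * enorm v.
  by rewrite -mulN1r -dotvZl scaleN1r -(enormN u) dotv_le_enorm.
(* The difference of squares factors into two terms, nonnegative by the bounds [h1] and [h2] on
   [dotv u v] and its opposite. *)
rewrite -!sqr_enorm -exprMn -subr_ge0 subr_sqr mulr_ge0 ?subr_ge0 //.
by rewrite -lerBlDr sub0r.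
Qed.

Lemma enormD (R : realType) (m : nat) (u v : 'cV[R]_m) :
  enorm (u + v) <= enorm u + enorm v.
Proof.
rewrite -(ler_pXn2r (n := 2)) ?nnegrE ?addr_ge0 ?enorm_ge0 //.
rewrite sqr_enorm dotvDl ![dotv _ (_ + _)]dotvC !dotvDl (dotvC v u).
by rewrite -!sqr_enorm; have := dotv_le_enorm u v; nra.
Qed.

(** Cauchy-Schwarz applied to each row. The constant is the squared Frobenius norm of [M]; this
    crude bound serves to show that the supremum in [specnorm] is finite. *)
Lemma sqr_enorm_mulmx_le (R : realType) (m n : nat) (M : 'M[R]_(m, n))
    (v : 'cV[R]_n) :
  enorm (M *m v) ^+ 2 <=
    (\sum_i dotv (row i M)^T (row i M)^T) * enorm v ^+ 2.
Proof.
rewrite !sqr_enorm mulr_suml; apply: ler_sum => i _; rewrite -expr2.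
have -> : (M *m v) i 0 = dotv (row i M)^T v.
  by rewrite mxE; apply: eq_bigr => j _; rewrite !mxE.
exact: sqr_dotv_le.
Qed.

Lemma enorm_mulmx_ball_le_specnorm (R : realType) (m n : nat)
    (M : 'M[R]_(m, n)) (v : 'cV[R]_n) :
  enorm v <= 1 -> enorm (M *m v) <= specnorm M.
Proof.
move=> v1; apply: ub_le_sup; last by exists v.
(* [ub_le_sup] asks for an upper bound of the set; the Frobenius norm of [M] is one. *)
exists (Num.sqrt (\sum_i dotv (row i M)^T (row i M)^T)) => _ [w /= w1 <-].
have F0 : 0 <= \sum_i dotv (row i M)^T (row i M)^T.
  by apply: sumr_ge0 => i _; exact: dotv_ge0.
rewrite -(ler_pXn2r (n := 2)) ?nnegrE ?enorm_ge0 ?sqrtr_ge0 //.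
rewrite [leRHS]sqr_sqrtr //.
apply: le_trans (sqr_enorm_mulmx_le M w) _.
by rewrite ler_piMr // expr_le1 // enorm_ge0.
Qed.

Lemma specnorm_ge0 (R : realType) (m n : nat) (M : 'M[R]_(m, n)) :
  0 <= specnorm M.
Proof.
apply: le_trans (enorm_ge0 (M *m 0)) _.
by apply: enorm_mulmx_ball_le_specnorm; rewrite enorm0.
Qed.

(** Homogeneity extends the unit-ball estimate to every vector by normalising it; the zero vector is
    treated apart. *)
Lemma enorm_mulmx_le (R : realType) (m n : nat) (M : 'M[R]_(m, n))
    (v : 'cV[R]_n) :
  enorm (M *m v) <= specnorm M * enorm v.
Proof.
have [v0|v0] := eqVneq (enorm v) 0.
  by rewrite v0 (enorm_eq0 v0) mulmx0 enorm0 mulr0.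
have v_gt0 : 0 < enorm v by rewrite lt0r v0 enorm_ge0.
have := @enorm_mulmx_ball_le_specnorm _ _ _ M ((enorm v)^-1 *: v).
rewrite -scalemxAr !enormZ ger0_norm ?invr_ge0 ?enorm_ge0 // mulVf //.
by move=> /(_ (lexx _)); rewrite mulrC ler_pdivrMr.
Qed.

(** With [w = M^T *m v], the square of [enorm w] equals [dotv v (M *m w)], at most
    [enorm v * specnorm M * enorm w]; cancelling [enorm w] gives the claim without comparing the
    spectral norms of [M] and [M^T]. *)
Lemma enorm_trmx_mulmx_le (R : realType) (m n : nat) (M : 'M[R]_(m, n))
    (v : 'cV[R]_m) :
  enorm (M^T *m v) <= specnorm M * enorm v.
Proof.
have [->|w0] := eqVneq (enorm (M^T *m v)) 0.
  by rewrite mulr_ge0 ?specnorm_ge0 ?enorm_ge0.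
have w_gt0 : 0 < enorm (M^T *m v) by rewrite lt0r w0 enorm_ge0.
rewrite -(ler_pM2r w_gt0) -expr2 sqr_enorm dotv_trmx.
apply: le_trans (dotv_le_enorm _ _) _.
rewrite [specnorm M * _]mulrC -mulrA ler_wpM2l ?enorm_ge0 //.
exact: enorm_mulmx_le.
Qed.

Lemma cfom_solution_eq (R : realType) (N NI NO K : nat) (S : fom R N NI NO)
    (dt : R) (t : nat -> R) (x xc : nat -> 'cV[R]_N) :
  Eim S dt \in unitmx -> cfom_solution S K dt t x xc ->
  forall k, (k <= K)%N -> xc k = x k.
Proof.
move=> uE [xc0 xcS]; elim=> [//|k IH] kK.
have := xcS k.+1 kK.
(* By induction both models have the same state at step [k], so the right-hand side cancels against
   the one inside the defect, leaving [Eim] applied to each of the two new states. *)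
rewrite /defect /= IH 1?ltnW // addrC subrK.
move=> /(congr1 (mulmx (invmx (Eim S dt)))).
by rewrite !mulKmx.
Qed.

(** Transposing the definition of the dual residual expresses [fomC S] through [res_du] and [Eim];
    the signs come from [Cdu], which is minus the transpose of [fomC S]. *)
Lemma fomC_mulmx (R : realType) (N NI NO : nat) (S : fom R N NI NO)
    (dt : R) (xtdu : 'M[R]_(N, NO)) (e : 'cV[R]_N) :
  fomC S *m e =
    - ((res_du S dt xtdu)^T *m e) - xtdu^T *m (Eim S dt *m e).
Proof.
rewrite /res_du /Cdu /Edu linearB /= linearN /= trmxK trmx_mul trmxK.
by rewrite mulmxBl mulNmx -mulmxA opprB opprK addrC addrA addNr add0r.
Qed.

Theorem theorem3p1 (R : realType) (p N NI NO n q K : nat)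
    (P : set 'cV[R]_p) (dt : R) (t : nat -> R)
    (S : 'cV[R]_p -> fom R N NI NO)
    (x xc : 'cV[R]_p -> nat -> 'cV[R]_N)
    (V : 'cV[R]_p -> 'M[R]_(N, n))
    (z : 'cV[R]_p -> nat -> 'cV[R]_n)
    (Vdu : 'cV[R]_p -> 'M[R]_(N, q))
    (zdu : 'cV[R]_p -> 'M[R]_(q, NO))
    (hgrid : uniform_grid K dt t)
    (hx0 : forall mu, P mu -> x mu 0%N = fomx0 (S mu))
    (hxc : forall mu, P mu -> cfom_solution (S mu) K dt t (x mu) (xc mu))
    (hV : forall mu, P mu -> orthonormal_columns (V mu))
    (hz : forall mu, P mu -> crom_solution (S mu) K dt t (x mu) (V mu) (z mu))
    (hzdu : forall mu, P mu -> dual_rom_solution (S mu) dt (Vdu mu) (zdu mu))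
    (hE : forall mu, P mu -> Eim (S mu) dt \in unitmx) :
  forall mu, P mu -> forall k, (1 <= k <= K)%N ->
    let y := fomC (S mu) *m x mu k in
    let xt := fun j => V mu *m z mu j in
    let xtdu := Vdu mu *m zdu mu in
    let ybar := modified_output (S mu) dt t (x mu) (V mu) (z mu) xtdu k in
    let r := res (S mu) dt t (x mu) xt k in
    let rbreve := aux_res (S mu) dt t (x mu) (xc mu) xt k in
    let rdu := res_du (S mu) dt xtdu in
    enorm (y - ybar) <=
      specnorm (invmx (Eim (S mu) dt)) * specnorm rdu * enorm rbreve
      + specnorm xtdu * enorm (r - rbreve).
Proof.
move=> mu Pmu k /andP[_ kK]; lazy zeta.
set y := fomC _ *m _; set xt := (fun j => _); set xtdu := Vdu mu *m _.
set ybar := modified_output _ _ _ _ _ _ _ _.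
set rbreve := aux_res _ _ _ _ _ _ _; set rdu := res_du _ _ _.
set r := res _ _ _ _ _ _.
have uE := hE mu Pmu.
have xck := cfom_solution_eq uE (hxc mu Pmu).
have rbreveE : rbreve = Eim (S mu) dt *m (x mu k - xt k).
  (* Once [xc] is replaced by the snapshot at [k.-1], the scheme's right-hand side cancels against
     the defect. *)
  rewrite /rbreve /aux_res xck ?(leq_trans (leq_pred _)) //.
  by rewrite /defect mulmxBr [X in X - _]addrC subrK.
have errE : y - ybar =
    - (rdu^T *m (invmx (Eim (S mu) dt) *m rbreve)) + xtdu^T *m (r - rbreve).
  have -> : y - ybar = fomC (S mu) *m (x mu k - xt k) + xtdu^T *m r.
    rewrite /ybar /modified_output -/xt -/r (mulmxBr (fomC _)) mulmxA.
    by rewrite opprB addrCA addrC.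
  (* The state error is kept inside [Eim] as [rbreve] in the [xtdu] term, while in the [rdu] term
     the inverse of [Eim] applied to [rbreve] collapses back to that error. *)
  rewrite (fomC_mulmx _ dt xtdu) -rbreveE {2}rbreveE mulKmx //.
  by rewrite (mulmxBr xtdu^T r) -addrA [X in _ = _ + X]addrC.
rewrite errE; apply: le_trans (enormD _ _) _; rewrite enormN lerD //.
  apply: le_trans (enorm_trmx_mulmx_le _ _) _.
  rewrite [leRHS]mulrAC mulrC ler_wpM2r ?specnorm_ge0 //.
  exact: enorm_mulmx_le.
exact: enorm_trmx_mulmx_le.
Qed.
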